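(* Let $q$ be a prime power and let $n \geq 1$ be an integer. (a) Assume that we are in neither of the following two cases: (i) $q$ is prime and $n = 1$; (ii) $q = 2$ and $n = 2$. Then for every automorphism $\Psi$ of $\mathbb{P}^n$ with fractional jump $\psi : \mathbb{A}^n \to \mathbb{A}^n$, $\Psi$ acts transitively on $\mathbb{P}^n$ if and only if $\psi$ acts transitively on $\mathbb{A}^n$. (b) In each of the exceptional cases the equivalence fails: if $q$ is prime and $n = 1$, or if $q = 2$ and $n = 2$, there exists an automorphism $\Psi$ of $\mathbb{P}^n$ whose fractional jump $\psi$ acts transitively on $\mathbb{A}^n$ while $\Psi$ does not act transitively on $\mathbb{P}^n$.
   Context: $\mathbb{F}_q$ is the finite field with $q$ elements. $\mathbb{A}^n = \mathbb{F}_q^n$ denotes the $n$-dimensional affine space, as a set of $\mathbb{F}_q$-points, and $\mathbb{P}^n$ is the $n$-dimensional projective space over $\mathbb{F}_q$, i.e. the set of $\mathbb{F}_q$-points $[X_0 : \ldots : X_n]$. An automorphism of $\mathbb{P}^n$ is an element of $\mathrm{PGL}_{n+1}(\mathbb{F}_q) = \mathrm{GL}_{n+1}(\mathbb{F}_q)/\mathbb{F}_q^* \mathrm{Id}$, acting on $\mathbb{P}^n$ in the usual way. Write $\mathbb{P}^n = U \cup H$ with $U = \{[X_0 : \ldots : X_n] : X_n \neq 0\}$ and $H = \{[X_0 : \ldots : X_n] : X_n = 0\}$, and let $\pi : \mathbb{A}^n \to U$ be the bijection $(x_1, \ldots, x_n) \mapsto [x_1 : \ldots : x_n : 1]$. Let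 $\Psi$ be an automorphism of $\mathbb{P}^n$. For $P \in U$ the fractional jump index of $\Psi$ at $P$ is $\mathfrak{J}_P = \min\{k \in \mathbb{Z}_{\geq 1} : \Psi^k(P) \in U\}$. The fractional jump of $\Psi$ is the map $\psi : \mathbb{A}^n \to \mathbb{A}^n$, $\psi(x) = \pi^{-1}\big(\Psi^{\mathfrak{J}_{\pi(x)}}(\pi(x))\big)$ (this is a bijection). A bijective map $f : X \to X$ acts transitively on $X$ if for any $x, y \in X$ there exists $k \in \mathbb{Z}$ such that $y = f^k(x)$. *)

(* Defs.v *)
From HB Require Import structures.
From mathcomp Require Import all_boot all_order all_fingroup all_algebra.
From mathcomp Require Import generic_quotient.

Set Implicit Arguments.
Unset Strict Implicit.
Unset Printing Implicit Defensive.

Import GRing.Theory.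
Local Open Scope ring_scope.
Local Open Scope quotient_scope.

Section ProjectiveSpace.
Variables (F : finFieldType) (n : nat).

Definition homvec := {v : 'cV[F]_n.+1 | v != 0}.

Definition proportional (v w : homvec) : bool :=
  [exists c : F, (c != 0) && (val w == c *: val v)].

Lemma proportional_refl : reflexive proportional.
Proof.
by move=> v; apply/existsP; exists 1; rewrite oner_eq0 scale1r eqxx.
Qed.

Lemma proportional_sym : symmetric proportional.
Proof.
suff sub v w : proportional v w -> proportional w v.
  by move=> v w; apply/idP/idP; apply: sub.
case/existsP=> c /andP[c0 /eqP vw]; apply/existsP; exists c^-1.
by rewrite invr_eq0 c0 vw scalerA mulVf // scale1r eqxx.
Qed.

Lemma proportional_trans : transitive proportional.
Proof.
move=> v u w /existsP[c /andP[c0 /eqP uv]] /existsP[d /andP[d0 /eqP vw]].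
by apply/existsP; exists (d * c); rewrite mulf_neq0 // vw uv scalerA eqxx.
Qed.

Canonical proportional_equiv :=
  EquivRel proportional proportional_refl proportional_sym proportional_trans.

Definition projspace := {eq_quot proportional_equiv}.
HB.instance Definition _ := Choice.on projspace.
HB.instance Definition _ := EqQuotient.on projspace.
HB.instance Definition _ : isCountable projspace :=
  CanIsCountable (@reprK _ projspace).
HB.instance Definition _ : isFinite projspace :=
  CanIsFinite (@reprK _ projspace).

Definition homclass (v : homvec) : projspace := \pi_projspace v.

(* A system of homogeneous coordinates of P (well defined up to a scalar). *)
Definition homcoord (P : projspace) : 'cV[F]_n.+1 := val (repr P).

Lemma homclass_eq (v w : homvec) :
  (homclass v == homclass w) = proportional v w.
Proof. by rewrite /homclass eqmodE. Qed.

Lemma homcoordK (P : projspace) (h : homcoord P != 0) :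
  homclass (exist _ (homcoord P) h) = P.
Proof.
rewrite -[RHS]reprK /homclass; congr (\pi_projspace _).
exact: val_inj.
Qed.

Lemma homcoord_class (v : homvec) :
  exists2 c : F, c != 0 & homcoord (homclass v) = c *: val v.
Proof.
have : proportional v (repr (homclass v)).
  by rewrite -homclass_eq /homclass reprK.
by case/existsP=> c /andP[c0 /eqP e]; exists c.
Qed.

Lemma homclass_scale (v w : homvec) (c : F) :
  val w = c *: val v -> homclass v = homclass w.
Proof.
move=> e; apply/eqP; rewrite homclass_eq; apply/existsP; exists c.
rewrite e eqxx andbT; apply: contra (valP w) => /eqP c0.
by rewrite e c0 scale0r.
Qed.

(* The index ord_max stands for the last homogeneous coordinate X_n. *)
Definition affine_part : {set projspace} :=
  [set P | homcoord P ord_max ord0 != 0].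

Lemma affine_part_class (v : homvec) :
  (homclass v \in affine_part) = (val v ord_max ord0 != 0).
Proof.
have [c c0 e] := homcoord_class v.
by rewrite inE e mxE mulf_eq0 (negPf c0).
Qed.

(* (x_1, ..., x_n) |-> (x_1, ..., x_n, 1) *)
Definition affine_vec (x : 'cV[F]_n) : 'cV[F]_n.+1 :=
  \col_i oapp (fun j => x j ord0) 1 (unlift ord_max i).

Lemma affine_vec_last x : affine_vec x ord_max ord0 = 1.
Proof. by rewrite mxE unlift_none. Qed.

Lemma affine_vec_neq0 x : affine_vec x != 0.
Proof.
apply/eqP => /matrixP /(_ ord_max ord0) /eqP.
by rewrite affine_vec_last mxE oner_eq0.
Qed.

Definition affine_homvec (x : 'cV[F]_n) : homvec :=
  exist _ (affine_vec x) (affine_vec_neq0 x).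

Definition affine_pt (x : 'cV[F]_n) : projspace := homclass (affine_homvec x).

Lemma affine_pt_in x : affine_pt x \in affine_part.
Proof. by rewrite affine_part_class /= affine_vec_last oner_eq0. Qed.

(* The inverse of affine_pt on affine_part:
   [X_0 : ... : X_n] |-> (X_0 / X_n, ..., X_(n-1) / X_n).
   Its values at infinity are irrelevant. *)
Definition affine_coord (P : projspace) : 'cV[F]_n :=
  \col_i (homcoord P (lift ord_max i) ord0 / homcoord P ord_max ord0).

Lemma affine_ptK : cancel affine_pt affine_coord.
Proof.
move=> x; apply/colP => i; rewrite mxE /affine_pt.
have [c c0 ->] := homcoord_class (affine_homvec x).
by rewrite /= !mxE unlift_none liftK /= mulr1 mulrC mulKf.
Qed.

Lemma affine_coordK : {in affine_part, cancel affine_coord affine_pt}.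
Proof.
move=> P; rewrite inE => P0.
have h : homcoord P != 0 := valP (repr P).
rewrite -[RHS](homcoordK h); apply: (@homclass_scale _ _ (homcoord P ord_max ord0)).
apply/colP => i /=; rewrite !mxE.
case: (unliftP ord_max i) => [j ->|->] /=; last by rewrite mulr1.
by rewrite mxE mulrC divfK.
Qed.

End ProjectiveSpace.

Section Automorphisms.
Variables (F : finFieldType) (n : nat).
Local Notation GL := {'GL_n.+1[F]}.

Lemma GL_mul_neq0 (A : GL) (v : 'cV[F]_n.+1) : v != 0 -> GLval A *m v != 0.
Proof.
apply: contra => /eqP Av0; rewrite -(mulKmx (GL_unitmx A) v).
by rewrite [X in _ *m X]Av0 mulmx0.
Qed.

Definition homvec_act (A : GL) (v : homvec F n) : homvec F n :=
  exist _ (GLval A *m val v) (GL_mul_neq0 A (valP v)).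

Definition GL_act (A : GL) (P : projspace F n) : projspace F n :=
  homclass (homvec_act A (repr P)).

Lemma GL_act_class (A : GL) (v : homvec F n) :
  GL_act A (homclass v) = homclass (homvec_act A v).
Proof.
have [c c0 e] := homcoord_class v; apply/esym/(@homclass_scale _ _ _ _ c).
by rewrite /= scalemxAr -e.
Qed.

Lemma GL_act_inj (A : GL) : injective (GL_act A).
Proof.
move=> P Q /eqP; rewrite homclass_eq => /existsP[c /andP[c0 /eqP /= e]].
rewrite -[P]reprK -[Q]reprK; apply: (@homclass_scale _ _ _ _ c).
by apply: (can_inj (mulKmx (GL_unitmx A))); rewrite e -scalemxAr.
Qed.

Definition scalar_GL : {set GL} := [set A : GL | is_scalar_mx (GLval A)].

Lemma scalar_GL_group : group_set scalar_GL.
Proof.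
apply/group_setP; split=> [|A B].
  by rewrite inE; apply/is_scalar_mxP; exists 1.
rewrite !inE => /is_scalar_mxP[a Aa] /is_scalar_mxP[b Bb].
apply/is_scalar_mxP; exists (a * b).
by rewrite GL_MxE Aa Bb scalar_mxM.
Qed.
Canonical scalar_GL_gr := Group scalar_GL_group.

Lemma scalar_GL_central (A : GL) : A \in 'C(scalar_GL)%g.
Proof.
apply/centP => B; rewrite inE => /is_scalar_mxP[b Bb]; apply: val_inj.
by have := scalar_mxC b (GLval A); rewrite -Bb => e; apply/esym.
Qed.

Lemma scalar_GL_norm (A : GL) : A \in 'N(scalar_GL)%g.
Proof. exact: (subsetP (cent_sub _)) (scalar_GL_central A). Qed.

Definition PGL := coset_of scalar_GL.

(* Ψ : PGL as a permutation of the projective space, through an arbitrary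
   representative; see PGL_perm_class. *)
Definition PGL_perm (Psi : PGL) : {perm projspace F n} :=
  perm (@GL_act_inj (fingroup.repr Psi)).

Lemma PGL_perm_class (A : GL) (v : homvec F n) :
  PGL_perm (coset scalar_GL A) (homclass v) = homclass (homvec_act A v).
Proof.
rewrite permE GL_act_class.
have : fingroup.repr (coset scalar_GL A) \in (scalar_GL :* A)%g.
  rewrite -(val_coset (scalar_GL_norm A)); exact: mem_repr_coset.
case/rcosetP=> B; rewrite inE => /is_scalar_mxP[b Bb] eA.
apply/esym/(@homclass_scale _ _ _ _ b) => /=.
by rewrite eA GL_MxE Bb mul_scalar_mx -scalemxAl.
Qed.

End Automorphisms.

Definition perm_zpow (T : finType) (s : {perm T}) (k : int) : {perm T} :=
  match k with
  | Posz m => (s ^+ m)%g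
  | Negz m => (s ^- m.+1)%g
  end.

Definition acts_transitively (T : finType) (s : {perm T}) : Prop :=
  forall x y : T, exists k : int, y = perm_zpow s k x.

Section FractionalJump.
Variables (F : finFieldType) (n : nat) (Psi : PGL F n).
Local Notation U := (affine_part F n).

Lemma jump_exists (P : projspace F n) : P \in U ->
  exists k : nat, (1 <= k)%N && ((PGL_perm Psi ^+ k)%g P \in U).
Proof.
move=> UP; exists #[PGL_perm Psi]%g.
by rewrite order_gt0 expg_order perm1.
Qed.

Definition jump_index (P : projspace F n) (UP : P \in U) : nat :=
  ex_minn (jump_exists UP).

Definition fractional_jump_fun (x : 'cV[F]_n) : 'cV[F]_n :=
  affine_coord
    ((PGL_perm Psi ^+ jump_index (affine_pt_in x))%g (affine_pt x)).

Lemma fractional_jump_inj : injective fractional_jump_fun.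
Proof.
move=> x y; rewrite /fractional_jump_fun /jump_index.
case: ex_minnP => i /andP[i0 Ui] mini; case: ex_minnP => j /andP[j0 Uj] minj.
move/(congr1 (@affine_pt F n)); rewrite !affine_coordK //.
wlog le_ij : x y i j i0 j0 Ui Uj mini minj / (i <= j)%N.
  move=> W; case/orP: (leq_total i j) => le; first exact: W le.
  by move/esym => e; apply/esym; apply: W le e.
rewrite -(subnK le_ij) expgD permM => /perm_inj e.
case: (posnP (j - i)%N) => [d0|d_gt0].
  by move: e; rewrite d0 expg0 perm1 => /(can_inj (@affine_ptK F n)).
have := minj (j - i)%N; rewrite d_gt0 -e affine_pt_in => /(_ isT).
by rewrite leqNgt ltn_subrL i0 j0.
Qed.

Definition fractional_jump : {perm 'cV[F]_n} := perm fractional_jump_inj.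

End FractionalJump.

(* Main.v *)
Require Import Defs.
From mathcomp Require Import all_boot all_order all_fingroup all_algebra.
From mathcomp Require Import cyclic finfield mxabelem.

(** The fractional jump of Psi is the first return map of Psi to the affine
part U, so two points of the affine space lie in the same orbit of the jump if
and only if the corresponding points of U lie in the same orbit of Psi
([porbit_fractional_jump]). Transitivity of Psi thus implies transitivity of
its jump, and transitivity of the jump says that U is contained in a single
orbit O of Psi.

Suppose that this holds and let A be a matrix of Psi, of size m = n + 1. Let W
be the largest A-invariant subspace of the hyperplane X_n = 0, that is, the set
of the v such that the last coordinate of every A^k v is zero. A point is in O
exactly when its coordinate vectors are outside W. Put w = dim W and
r = m - w > 0; Psi is transitive if and only if w = 0. Suppose w > 0, and let q
be the order of the field and p its characteristic.

- Counting vectors, (q - 1) |O| = q^m - q^w = q^w (q^r - 1). As |O| divides the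
  order of A, so does q^w ([dvdn_order_repr]).
- Let t be the p'-part of the order of A and M = A^t - 1. The order of A^t is a
  power of p that is at least q^w, so M is nilpotent, and if s is the last
  exponent with M^s <> 0 then q^w <= p s ([order_unipotent_part]).
- M^s is nonzero and commutes with A. If it killed a vector outside W it would
  kill all of them, since they are all proportional to vectors of a single
  A-orbit; they span the whole space, so M^s would be zero. Hence
  ker M^s is contained in W, that is, M^s has rank at least r
  ([observability_sub]).
- Each of the s + 1 steps of the filtration by the images of the powers of M
  drops the rank by at least rank M^s ([mxrank_nilpotent]). So
  r (s + 1) <= m, that is, r s <= w.

Together, r q^w <= p w ([PGL_observability_bound]), which leaves only r = w = 1
with q = p, and r = 1, w = 2 with q = 2 ([exceptional_parameters]): the two
exceptional cases.

In these cases, take for Psi the class of the unipotent Jordan block of size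
n + 1. It fixes the point [1 : 0 : ... : 0] at infinity, and the coordinates of
the k-th iterate of the origin of the affine space are the binomial
coefficients C(k, n), ..., C(k, 1), which take all values modulo p if n = 1,
and all pairs of values modulo 2 if n = 2. *)

Set Implicit Arguments.
Unset Strict Implicit.
Unset Printing Implicit Defensive.

Import GRing.Theory.
Local Open Scope ring_scope.

(** * Orbits of the fractional jump *)

Lemma acts_transitivelyP (T : finType) (s : {perm T}) :
  acts_transitively s <-> forall x y, y \in porbit s x.
Proof.
split=> [tr x y | tr x y].
  have [[k|k] ->] := tr x y; first exact: mem_porbit.
  by rewrite porbit_sym /=; apply/porbitP; exists k.+1; rewrite permKV.
by have /porbitP[i ->] := tr x y; exists (Posz i).
Qed.

Lemma porbit_trans (T : finType) (s : {perm T}) (x y z : T) :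
  y \in porbit s x -> z \in porbit s y -> z \in porbit s x.
Proof. by rewrite -eq_porbit_mem => /eqP <-. Qed.

Section FirstReturn.
Variables (F : finFieldType) (n : nat) (Psi : PGL F n).
Local Notation U := (affine_part F n).
Local Notation psi := (fractional_jump Psi).

(** The jump at x is the first return of [affine_pt x] to U. *)
Lemma fractional_jumpP x :
  exists2 j : nat, (0 < j)%N /\
    (forall k : nat, (0 < k)%N -> (PGL_perm Psi ^+ k)%g (affine_pt x) \in U ->
       (j <= k)%N)
    & affine_pt (psi x) = (PGL_perm Psi ^+ j)%g (affine_pt x).
Proof.
rewrite permE /fractional_jump_fun /jump_index.
case: ex_minnP => j /andP[j0 Uj] minj; exists j; last by rewrite affine_coordK.
by split=> // k k0 Uk; apply: minj; rewrite k0.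
Qed.

Lemma porbit_fractional_jump x y :
  (y \in porbit psi x) = (affine_pt y \in porbit (PGL_perm Psi) (affine_pt x)).
Proof.
apply/idP/idP.
  case/porbitP=> k ->; elim: k => [|k IH]; first by rewrite perm1 porbit_id.
  rewrite expgSr permM; have [j _ ->] := fractional_jumpP ((psi ^+ k)%g x).
  exact: porbit_trans IH (mem_porbit _ _ _).
case/porbitP=> k; elim/ltn_ind: k x => k IH x.
have [->|k0] := posnP k.
  by rewrite perm1 => /(can_inj (@affine_ptK F n)) ->; apply: porbit_id.
move=> e; have [j [j0 minj] ej] := fractional_jumpP x.
have lejk : (j <= k)%N by apply: minj; rewrite -?e ?affine_pt_in.
have /IH /(_ (psi x)) : (k - j < k)%N by rewrite ltn_subrL j0.
rewrite ej -permM -expgD subnKC // => /(_ e) psixy.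
by apply: porbit_trans psixy; apply: (mem_porbit psi 1).
Qed.

End FirstReturn.

(** * Nilpotent matrices and unipotent parts *)

(** The kernel of M on the image of M^j contains the image of M^s. *)
Lemma mxrank_nilpotent_step (F : fieldType) (m s j : nat) (M : 'M[F]_m.+1) :
  M ^+ s.+1 = 0 -> (j <= s)%N ->
  (\rank (M ^+ s) + \rank (M ^+ j.+1) <= \rank (M ^+ j))%N.
Proof.
move=> M0 js; rewrite exprSr -(mxrank_mul_ker (M ^+ j) M) addnC leq_add2l.
apply: mxrankS; rewrite sub_capmx; apply/andP; split.
  by rewrite -(subnK js) exprD; apply: submxMl.
by apply/sub_kermxP; rewrite [_ *m _](_ : _ = M ^+ s.+1) // exprSr.
Qed.

Lemma mxrank_nilpotent (F : fieldType) (m s : nat) (M : 'M[F]_m.+1) :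
  M ^+ s.+1 = 0 -> (s.+1 * \rank (M ^+ s) <= m.+1)%N.
Proof.
move=> M0; suff /(_ s.+1 (leqnn _)) : forall j, (j <= s.+1)%N ->
    (j * \rank (M ^+ s) + \rank (M ^+ j) <= m.+1)%N.
  exact/leq_trans/leq_addr.
elim=> [|j IH] js; first by rewrite mul0n add0n rank_leq_row.
apply: leq_trans (IH (ltnW js)); rewrite mulSn addnAC addnC leq_add2l.
by apply: mxrank_nilpotent_step; last rewrite -ltnS.
Qed.

Lemma exprB1_pchar (R : nzRingType) (p a : nat) (x : R) :
  p \in [pchar R] -> (x - 1) ^+ (p ^ a) = x ^+ (p ^ a) - 1.
Proof.
move=> pR; elim: a => [|a IH]; first by rewrite !expr1.
rewrite expnSr !exprM IH -!(pFrobenius_autE pR) pFrobenius_autB_comm.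
  by rewrite pFrobenius_aut1.
exact: commr1.
Qed.

(** For t the p'-part of N, the (N`_p / p)-th power of x^t - 1 is x^(N / p) - 1,
which is nonzero, and its N`_p-th power is x^N - 1 = 0. *)
Lemma order_unipotent_part (R : nzRingType) (p N : nat) (x : R) :
    p \in [pchar R] -> (p %| N)%N -> (0 < N)%N ->
    x ^+ N = 1 -> x ^+ (N %/ p) != 1 ->
  exists t s : nat, [/\ (N`_p <= p * s)%N,
    (x ^+ t - 1) ^+ s != 0 & (x ^+ t - 1) ^+ s.+1 = 0].
Proof.
move=> pR pN N0 xN xNp.
have pp := pcharf_prime pR.
have a0 : (0 < logn p N)%N by rewrite logn_gt0 mem_primes pp N0.
set a := (logn p N).-1; have aE : logn p N = a.+1 by rewrite prednK.
pose t := (N`_p^')%N; have NE : (N = t * p ^ a.+1)%N.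
  by rewrite -{1}(partnC p N0) mulnC p_part aE.
pose M := x ^+ t - 1.
have Mp : M ^+ (p ^ a.+1) = 0 by rewrite exprB1_pchar // -exprM -NE xN subrr.
have Mp' : M ^+ (p ^ a) != 0.
  rewrite exprB1_pchar // -exprM subr_eq0; apply: contra xNp => /eqP <-.
  by rewrite NE expnSr mulnA mulnK // prime_gt0.
have bd i : M ^+ i != 0 -> (i <= p ^ a.+1)%N.
  by apply: contraR; rewrite -ltnNge => /ltnW/subnK <-; rewrite exprD Mp mulr0.
have ex : exists i, M ^+ i != 0 by exists (p ^ a)%N.
have [s Ms maxs] := ex_maxnP ex bd.
exists t, s; split=> //.
  by rewrite p_part aE expnS leq_mul2l maxs ?orbT.
by apply/eqP; apply: contraT => /maxs; rewrite ltnn.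
Qed.

(** * Counting vectors *)

(** Every point has q - 1 systems of homogeneous coordinates. *)
Lemma card_homclass_preim (F : finFieldType) (n : nat)
    (O : {set projspace F n}) :
  #|[set v : homvec F n | homclass v \in O]| = (#|O| * #|F|.-1)%N.
Proof.
rewrite -sum1_card (partition_big (@homclass F n) [in O]) /=; last first.
  by move=> v; rewrite inE.
rewrite -sum_nat_const; apply: eq_bigr => P PO; rewrite sum1_card.
have Pn0 : homcoord P != 0 := valP (generic_quotient.repr P).
have cPn0 (c : {c : F | c != 0}) : val c *: homcoord P != 0.
  by rewrite scaler_eq0 negb_or Pn0 (valP c).
pose f (c : {c : F | c != 0}) : homvec F n :=
  exist (fun v => v != 0) (val c *: homcoord P) (cPn0 c).
have f_inj : injective f.
  move=> c d /(congr1 val) /= /eqP; rewrite -subr_eq0 -scalerBl scaler_eq0.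
  by rewrite (negPf Pn0) orbF subr_eq0 => /eqP/val_inj.
transitivity #|codom f|; last first.
  rewrite card_codom // card_sig -(cardC1 (0 : F)).
  by apply: eq_card => c; rewrite !inE.
apply: eq_card => v; rewrite unfold_in /=; apply/andP/codomP.
  case=> _ /eqP vP.
  have [c c0 vc] := homcoord_class v.
  have c'0 : c^-1 != 0 by rewrite invr_eq0.
  exists (exist _ c^-1 c'0); apply: val_inj => /=.
  by rewrite -vP vc scalerA mulVf // scale1r.
case=> c ->; suff fcP : homclass (f c) = P by rewrite !inE fcP PO eqxx.
rewrite -[RHS](homcoordK Pn0).
apply: (@homclass_scale _ _ _ _ (val c)^-1).
by rewrite /= scalerA mulVf ?scale1r // (valP c).
Qed.

Lemma card_mulmx_neq0 (F : finFieldType) (m n : nat) (R : 'M[F]_(m, n)) :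
  #|[set v : 'cV[F]_n | R *m v != 0]|
    = (#|F| ^ (n - \rank R) * (#|F| ^ \rank R).-1)%N.
Proof.
have := cardsC [set v : 'cV[F]_n | R *m v == 0].
have -> : #|[set v : 'cV[F]_n | R *m v == 0]| = (#|F| ^ (n - \rank R))%N.
  rewrite -(mxrank_tr R) -mxrank_ker -card_rowg -(card_imset _ trmx_inj).
  apply: eq_card => u; apply/imsetP/idP => [[v] |].
    rewrite !inE => /eqP Rv ->; apply/sub_kermxP.
    by rewrite -trmx_mul Rv trmx0.
  rewrite inE => /sub_kermxP uR; exists u^T; last by rewrite trmxK.
  by rewrite inE -(trmxK R) -trmx_mul uR trmx0.
have -> : ~: [set v : 'cV[F]_n | R *m v == 0] = [set v | R *m v != 0].
  by apply/setP=> v; rewrite !inE.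
have -> : #|{: 'cV[F]_n}| = (#|F| ^ (n - \rank R) * #|F| ^ \rank R)%N.
  by rewrite card_mx muln1 -expnD subnK // rank_leq_col.
by rewrite -subn1 mulnBr muln1 => <-; rewrite addKn.
Qed.

Lemma pchar_pnat_card (F : finFieldType) (p : nat) :
  p \in [pchar F] -> p.-nat #|F|.
Proof.
move=> pF; rewrite (card_pprimeChar pF) pnatX pnat_id //.
exact: pcharf_prime pF.
Qed.

Lemma pchar_dvdn_card (F : finFieldType) (p : nat) :
  p \in [pchar F] -> (p %| #|F|)%N.
Proof.
move=> pF; have [[|e] qe] := p_natP (pchar_pnat_card pF).
  by have := card_finNzRing_gt1 F; rewrite qe.
by rewrite qe dvdn_exp.
Qed.

(** * Automorphisms with the affine part in a single orbit *)

Section Observability.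
Variables (F : finFieldType) (n : nat) (Psi : PGL F n).
Local Notation U := (affine_part F n).
Local Notation A := (fingroup.repr Psi).

Lemma PGL_perm_homclass v : PGL_perm Psi (homclass v) = homclass (homvec_act A v).
Proof. by rewrite permE GL_act_class. Qed.

Lemma PGL_perm_exp_homclass k v :
  (PGL_perm Psi ^+ k)%g (homclass v) = homclass (homvec_act (A ^+ k)%g v).
Proof.
elim: k => [|k IH].
  by rewrite perm1; congr homclass; apply: val_inj; rewrite /= mul1mx.
rewrite expgSr permM IH PGL_perm_homclass; congr homclass; apply: val_inj.
by rewrite expgS; apply: mulmxA.
Qed.

Lemma homclassP (P : projspace F n) : exists v, P = homclass v.
Proof.
by exists (generic_quotient.repr P); rewrite /homclass generic_quotient.reprK.
Qed.

Lemma PGL_perm_order : (PGL_perm Psi ^+ #[A] = 1)%g.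
Proof.
apply/permP=> P; have [v ->] := homclassP P.
rewrite PGL_perm_exp_homclass perm1; congr homclass.
by apply: val_inj; rewrite /= expg_order mul1mx.
Qed.

(** The matrix whose k-th row is the last row of A^k, for k less than the order
of A; this covers all the powers of A. Its kernel on column vectors is the
largest A-invariant subspace W of the hyperplane X_n = 0, so its rank is the
codimension r of W. *)
Definition observability_mx : 'M[F]_(#[A]%g, n.+1) :=
  \matrix_(k < #[A]%g, j < n.+1) GLval (A ^+ k)%g ord_max j.

Lemma observability_mxP (v : 'cV[F]_n.+1) :
  reflect (forall k, (GLval (A ^+ k)%g *m v) ord_max ord0 = 0)
          (observability_mx *m v == 0).
Proof.
apply: (iffP eqP) => [Rv k | Av].
  have kN : (k %% #[A]%g < #[A]%g)%N by rewrite ltn_mod order_gt0.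
  transitivity ((observability_mx *m v) (Ordinal kN) ord0).
    by rewrite !mxE; apply: eq_bigr => j _; rewrite !mxE /= expg_mod_order.
  by rewrite Rv mxE.
apply/colP=> k; transitivity ((GLval (A ^+ k)%g *m v) ord_max ord0).
  by rewrite !mxE; apply: eq_bigr => j _; rewrite mxE.
by rewrite Av mxE.
Qed.

(* From here on, U is contained in a single orbit O of Psi. *)
Hypothesis U_orbit :
  {in U &, forall P Q, Q \in porbit (PGL_perm Psi) P}.
Local Notation O := (porbit (PGL_perm Psi) (affine_pt 0)).
Local Notation R := observability_mx.

(** The orbit O is the complement of the projective space of W. *)
Lemma mem_affine_orbit v : (homclass v \in O) = (R *m val v != 0).
Proof.
apply/idP/idP => [|Rv].
  rewrite porbit_sym => /porbitP[k].
  rewrite PGL_perm_exp_homclass => e; apply/negP => /observability_mxP /(_ k).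
  by apply/eqP; rewrite -[_ *m _]/(val (homvec_act (A ^+ k)%g v))
     -affine_part_class -e affine_pt_in.
have [k Uk] : exists k, homclass (homvec_act (A ^+ k)%g v) \in U.
  pose z k := (GLval (A ^+ k)%g *m val v) ord_max ord0 == 0.
  case: (boolP [forall k : 'I_#[A]%g, z k]) => [/forallP z0|].
    case/negP: Rv; apply/observability_mxP => k.
    have kN : (k %% #[A]%g < #[A]%g)%N by rewrite ltn_mod order_gt0.
    by have /eqP := z0 (Ordinal kN); rewrite /= expg_mod_order.
  rewrite negb_forall => /existsP[k zk]; exists (val k).
  by rewrite affine_part_class.
rewrite porbit_sym; apply: porbit_trans (U_orbit Uk (affine_pt_in 0)).
by rewrite -PGL_perm_exp_homclass mem_porbit.
Qed.

Lemma observability_rank_gt0 : (0 < \rank R)%N.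
Proof.
rewrite lt0n mxrank_eq0; apply/negP => /eqP R0.
have := mem_affine_orbit (affine_homvec 0).
by rewrite porbit_id R0 mul0mx eqxx.
Qed.

Lemma transitive_full_rank :
  \rank R = n.+1 -> forall P Q, Q \in porbit (PGL_perm Psi) P.
Proof.
move=> rR; have inO P : P \in O.
  have [v ->] := homclassP P; rewrite mem_affine_orbit.
  apply/negP=> /eqP Rv; case/negP: (valP v); apply/eqP/trmx_inj.
  have freeR : row_free R^T by rewrite /row_free mxrank_tr rR.
  by apply: (row_free_inj freeR); rewrite -trmx_mul Rv !trmx0 mul0mx.
by move=> P Q; apply: (porbit_trans _ (inO Q)); rewrite porbit_sym.
Qed.

Lemma card_affine_orbit :
  (#|O| * #|F|.-1 = #|F| ^ (n.+1 - \rank R) * (#|F| ^ \rank R).-1)%N.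
Proof.
rewrite -card_homclass_preim -card_mulmx_neq0 -(card_imset _ val_inj).
apply: eq_card => v; apply/imsetP/idP => [[u] | ].
  by rewrite !inE mem_affine_orbit => Ru ->.
rewrite inE => Rv; have v0 : v != 0.
  by apply: contra Rv => /eqP->; rewrite mulmx0.
by exists (exist _ v v0); rewrite // inE mem_affine_orbit.
Qed.

Lemma dvdn_order_repr : (#|F| ^ (n.+1 - \rank R) %| #[A]%g)%N.
Proof.
apply: (@dvdn_trans #|O|); last first.
  apply: (@dvdn_trans #[PGL_perm Psi]%g).
    by rewrite porbitE orderE dvdn_orbit.
  by rewrite order_dvdn PGL_perm_order.
have q0 : (0 < #|F|)%N by apply: ltnW (card_finNzRing_gt1 F).
rewrite -(@Gauss_dvdl _ _ #|F|.-1) ?card_affine_orbit ?dvdn_mulr //.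
by apply: coprimeXl; rewrite coprime_sym coprimePn.
Qed.

(** In dual form, the conclusion says that the column kernel of M is contained
in W. *)
Lemma observability_sub (M : 'M[F]_n.+1) :
  GRing.comm M (GLval A) -> M != 0 -> (R <= M)%MS.
Proof.
move=> MA M0; rewrite submxE; apply: contraR M0 => RM.
have {RM}[v Rv Mv] : exists2 v : 'cV_n.+1, R *m v != 0 & M *m v = 0.
  have [j Rj] : exists j, R *m col j (cokermx M) != 0.
    apply/existsP; apply: contraR RM; rewrite negb_exists => /forallP Rj.
    apply/eqP/matrixP=> i j; have := Rj j; rewrite negbK colE mulmxA -colE.
    by move/eqP/colP/(_ i); rewrite !mxE.
  exists (col j (cokermx M)) => //.
  by rewrite colE mulmxA mulmx_coker mul0mx.
(* A vector outside W is proportional to some A ^+ k *m v. *)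
have killed (w : 'cV[F]_n.+1) : R *m w != 0 -> M *m w = 0.
  move=> Rw.
  have nz (u : 'cV[F]_n.+1) : R *m u != 0 -> u != 0.
    by apply: contra => /eqP->; rewrite mulmx0.
  have : homclass (exist _ w (nz _ Rw)) \in
         porbit (PGL_perm Psi) (homclass (exist _ v (nz _ Rv))).
    apply: (@porbit_trans _ _ _ (affine_pt 0)); last by rewrite mem_affine_orbit.
    by rewrite porbit_sym mem_affine_orbit.
  case/porbitP=> k /eqP; rewrite PGL_perm_exp_homclass eq_sym homclass_eq.
  case/existsP=> c /andP[_ /eqP /= ->].
  rewrite -scalemxAr mulmxA.
  have -> : M *m GLval (A ^+ k)%g = GLval (A ^+ k)%g *m M.
    by rewrite (FinRing.val_unitX k A); apply: commrX.
  by rewrite -mulmxA Mv mulmx0 scaler0.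
apply/eqP/matrixP=> i j.
suff : M *m delta_mx j (ord0 : 'I_1) = 0.
  by rewrite -colE => /colP/(_ i); rewrite !mxE.
(* A basis vector in W is the difference of two vectors outside W. *)
have [R0|/killed //] := eqVneq (R *m delta_mx j (ord0 : 'I_1)) 0.
rewrite -[delta_mx j _](addrK v) mulmxBr Mv subr0 killed //.
by rewrite mulmxDr R0 add0r.
Qed.

(** The inequality r q^w <= p w. *)
Lemma PGL_observability_bound (p : nat) : p \in [pchar F] ->
  (\rank R < n.+1)%N ->
  (\rank R * #|F| ^ (n.+1 - \rank R) <= p * (n.+1 - \rank R))%N.
Proof.
move=> pF rR.
have pp := pcharf_prime pF.
have pM : p \in [pchar 'M[F]_n.+1] := rmorph_pchar (@scalar_mx F n.+1) pF.
set w := (n.+1 - \rank R)%N.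
have w0 : (0 < w)%N by rewrite subn_gt0.
have pqw : p.-nat (#|F| ^ w)%N by rewrite pnatX pchar_pnat_card.
have q_dvd := dvdn_order_repr.
have q_le : (#|F| ^ w <= #[A]%g`_p)%N.
  rewrite dvdn_leq ?part_gt0 // -(part_pnat_id pqw).
  exact: partn_dvd.
have p_dvd : (p %| #[A]%g)%N.
  apply: dvdn_trans q_dvd; apply: (@dvdn_trans #|F|); last by rewrite dvdn_exp.
  exact: pchar_dvdn_card.
have AX k : GLval A ^+ k = GLval (A ^+ k)%g by rewrite (FinRing.val_unitX k A).
have [|||t [s [Ns Ms Ms1]]] :=
  @order_unipotent_part _ p #[A]%g (GLval A) pM p_dvd.
- exact: order_gt0.
- by rewrite AX expg_order.
- rewrite AX; apply/eqP => e.
  have /eqP : (A ^+ (#[A]%g %/ p) = 1)%g by apply: val_inj.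
  rewrite -order_dvdn => /dvdn_leq.
  rewrite divn_gt0 ?prime_gt0 // dvdn_leq ?order_gt0 // => /(_ isT).
  by rewrite leqNgt ltn_Pdiv ?prime_gt1 ?order_gt0.
have Rsub : (R <= (GLval A ^+ t - 1) ^+ s)%MS.
  apply: observability_sub Ms; apply/commr_sym/commrX/commrB; last exact: commr1.
  exact/commrX.
have := mxrank_nilpotent Ms1.
have := mxrankS Rsub; set r := \rank R in w rR w0 q_le pqw *.
move=> le1 /(leq_trans (leq_mul (leqnn _) le1)).
rewrite mulSn -(leq_subRL _ (ltnW rR)) -/w => sr.
apply: (@leq_trans (r * (p * s))); last by rewrite mulnCA leq_mul2l mulnC sr orbT.
by rewrite leq_mul2l (leq_trans q_le) ?orbT.
Qed.

End Observability.

(** * The exceptional parameters *)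

Lemma ltn_exp2_pred w : (2 < w)%N -> (w < 2 ^ w.-1)%N.
Proof.
case: w => [|[|[|w]]] //= _; elim: w => // w IH.
by rewrite expnS mul2n -addnn -addn1 leq_add // expn_gt0.
Qed.

Lemma exceptional_parameters (p q r w : nat) :
    prime p -> (p <= q)%N -> (0 < r)%N -> (0 < w)%N ->
    (r * q ^ w <= p * w)%N ->
  [/\ r = 1, w = 1 & q = p]%N \/ [/\ r = 1, w = 2 & q = 2]%N.
Proof.
move=> /prime_gt1 p1 pq r0 w0 le.
have q1 : (1 < q)%N := leq_trans p1 pq.
have {}le_w : (r * q ^ w.-1 <= w)%N.
  rewrite -(leq_pmul2l (ltnW q1)) mulnCA -expnS prednK //.
  by apply: leq_trans le _; rewrite leq_mul2r pq orbT.
have w3 : (w < 3)%N.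
  rewrite ltnNge; apply/negP=> w3; move: le_w; apply/negP; rewrite -ltnNge.
  apply: leq_trans (ltn_exp2_pred w3) _.
  by rewrite -[leqLHS]mul1n leq_mul // leq_exp2r // -subn1 subn_gt0 ltnW.
case: w w0 w3 le le_w => [|[|[|//]]] // _ _ /=.
  rewrite expn1 muln1 muln1 => le le_r; left.
  have r1 : r = 1%N by apply/eqP; rewrite eqn_leq le_r.
  by split=> //; apply/eqP; rewrite eqn_leq pq andbT -[q]mul1n -r1.
rewrite expn1 => _ le2; right.
have q2 : (q <= 2)%N by apply: leq_trans le2; rewrite leq_pmull.
have r1 : (r <= 1)%N.
  by rewrite -(leq_pmul2r (ltnW q1)) mul1n; apply: leq_trans le2 q1.
by split=> //; apply/eqP; rewrite eqn_leq ?r1 ?r0 ?q2 ?q1.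
Qed.

(** * The automorphism given by a unipotent Jordan block *)

Lemma prime_card_natr (F : finFieldType) (x : F) :
  prime #|F| -> exists2 k : nat, (k < #|F|)%N & x = k%:R.
Proof.
move=> pF; have charF : #|F| \in [pchar F] := @card_finPcharP F _ 1 erefl pF.
pose f (k : 'I_#|F|) : F := k%:R.
have f_inj : injective f.
  move=> i j; wlog ij : i j / (i <= j)%N.
    by move=> W; case/orP: (leq_total i j) => [/W // | /W Wji /esym/Wji].
  move/eqP; rewrite eq_sym -subr_eq0 -natrB // -(dvdn_pcharf charF) => dv.
  apply/val_inj/eqP; rewrite eqn_leq ij /= -subn_eq0.
  case: posnP dv => // ji0 /(dvdn_leq ji0); rewrite leqNgt.
  by rewrite (leq_ltn_trans (leq_subr _ _)).
have /codomP[k ->] : x \in codom f by apply: inj_card_onto; rewrite ?card_ord.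
by exists k.
Qed.

Section JordanBlock.
Variables (F : finFieldType) (n : nat).

(** The upper triangular Jordan block of size n + 1 with eigenvalue 1. *)
Definition jordan_mx : 'M[F]_n.+1 :=
  \matrix_(i, j) ((j == i) + (j == i.+1 :> nat))%:R.

Lemma jordan_mx_mul (v : 'cV[F]_n.+1) i :
  (jordan_mx *m v) i ord0 =
    v i ord0 + \sum_(j < n.+1 | j == i.+1 :> nat) v j ord0.
Proof.
rewrite mxE (eq_bigr (fun j : 'I_n.+1 => (j == i)%:R * v j ord0
                       + (j == i.+1 :> nat)%:R * v j ord0)); last first.
  by move=> j _; rewrite mxE natrD mulrDl.
rewrite big_split /=; congr (_ + _).
  rewrite (bigD1 i) //= eqxx mul1r big1 ?addr0 // => j /negPf ->.
  by rewrite mul0r.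
rewrite [RHS]big_mkcond; apply: eq_bigr => j _.
by case: eqP => _; rewrite ?mul1r ?mul0r.
Qed.

Lemma jordan_mx_unit : jordan_mx \is a GRing.unit.
Proof.
suff : jordan_mx \in unitmx by [].
rewrite unitmxE -det_tr det_trig; last first.
  apply/is_trig_mxP => i j ij; rewrite !mxE.
  by rewrite -val_eqE /= ltn_eqF // ltn_eqF // ltnW.
rewrite big1 ?unitr1 // => i _; rewrite !mxE eqxx.
by rewrite ltn_eqF.
Qed.

(** The Jordan block as an element of the general linear group. *)
Definition jordan_GL : {'GL_n.+1[F]} := FinRing.unit _ jordan_mx_unit.

(** The automorphism of the projective space given by the Jordan block. *)
Definition jordan_PGL : PGL F n := coset (scalar_GL F n) jordan_GL.

Lemma jordan_perm_exp k (v : homvec F n) (u : homvec F n) :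
  val u = iter k (mulmx jordan_mx) (val v) ->
  (PGL_perm jordan_PGL ^+ k)%g (homclass v) = homclass u.
Proof.
elim: k u => [|k IH] u uE; first by rewrite perm1; congr homclass; apply: val_inj.
pose u' := iter k (homvec_act jordan_GL) v.
have u'E : val u' = iter k (mulmx jordan_mx) (val v).
  by rewrite /u'; elim: k {IH uE u'} => // k /= ->.
rewrite expgSr permM (IH _ u'E) PGL_perm_class; congr homclass.
by apply: val_inj; rewrite uE /= u'E.
Qed.

(** The coordinates of the iterates of the origin [0 : ... : 0 : 1]; the
induction step is Pascal's rule. *)
Lemma iter_jordan_mx k i :
  iter k (mulmx jordan_mx) (affine_vec 0) i ord0 = 'C(k, n - i)%:R.
Proof.
elim: k i => [|k IH] i /=.
  rewrite mxE bin0n subn_eq0; case: unliftP => [j|] ->.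
    by rewrite lift_max leqNgt ltn_ord /= mxE.
  by rewrite /= leqnn.
rewrite jordan_mx_mul IH; have [in_|] := ltnP i n.
  rewrite (big_pred1 (Ordinal (in_ : i.+1 < n.+1)%N)) ?IH => [|j].
    by rewrite -natrD -[(n - i)%N]prednK ?subn_gt0 // binS subnS.
  by [].
move=> le_ni; rewrite big_pred0 ?addr0 => [|j].
  by move: le_ni; rewrite -subn_eq0 => /eqP ->; rewrite !bin0.
by rewrite ltn_eqF // (leq_trans (ltn_ord j)).
Qed.

(** The point [1 : 0 : ... : 0] is fixed. *)
Lemma jordan_nontransitive :
  (1 <= n)%N -> ~ acts_transitively (PGL_perm jordan_PGL).
Proof.
move=> n1 /acts_transitivelyP tr.
have e0n0 : delta_mx ord0 ord0 != 0 :> 'cV[F]_n.+1.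
  by apply/eqP => /colP/(_ ord0)/eqP; rewrite !mxE oner_eq0.
pose e : homvec F n := exist (fun v => v != 0) _ e0n0.
have Ae : jordan_mx *m val e = val e.
  apply/colP=> i; rewrite jordan_mx_mul big1 ?addr0 // => j /eqP ji.
  by rewrite mxE -val_eqE /= ji.
have /porbitP[k] := tr (homclass e) (affine_pt 0).
rewrite (@jordan_perm_exp k e e) => [e0|]; last by rewrite iter_fix.
have := affine_pt_in (0 : 'cV[F]_n); rewrite e0 affine_part_class /= mxE.
by rewrite -val_eqE /= eqxx andbT gtn_eqF ?mulr0n ?eqxx.
Qed.

Lemma jordan_jump_transitive :
  (forall y : 'cV[F]_n, exists k, forall i, y i ord0 = 'C(k, n - i)%:R) ->
  acts_transitively (fractional_jump jordan_PGL).
Proof.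
move=> yk; suff orb y : y \in porbit (fractional_jump jordan_PGL) 0.
  apply/acts_transitivelyP=> x y.
  by apply: porbit_trans (orb y); rewrite porbit_sym.
rewrite porbit_fractional_jump; have [k ykE] := yk y; apply/porbitP; exists k.
apply/esym/jordan_perm_exp/colP=> i /=; rewrite iter_jordan_mx mxE.
case: unliftP => [j|] ->; last by rewrite /= subnn bin0.
by rewrite lift_max /= ykE.
Qed.

End JordanBlock.

(** * Transitivity of an automorphism and of its fractional jump *)

Lemma fractional_jump_transitive (F : finFieldType) (n : nat) (Psi : PGL F n) :
  acts_transitively (PGL_perm Psi) -> acts_transitively (fractional_jump Psi).
Proof.
move=> /acts_transitivelyP tr; apply/acts_transitivelyP => x y.
by rewrite porbit_fractional_jump.
Qed.

Lemma transitive_of_fractional_jump (F : finFieldType) (n : nat)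
    (Psi : PGL F n) :
    ~ (prime #|F| /\ n = 1%N) -> ~ (#|F| = 2%N /\ n = 2%N) ->
  acts_transitively (fractional_jump Psi) -> acts_transitively (PGL_perm Psi).
Proof.
move=> not_i not_ii /acts_transitivelyP tr; apply/acts_transitivelyP.
have U_orbit :
    {in affine_part F n &, forall P Q, Q \in porbit (PGL_perm Psi) P}.
  move=> P Q PU QU; rewrite -(affine_coordK PU) -(affine_coordK QU).
  by rewrite -porbit_fractional_jump.
apply: (transitive_full_rank U_orbit); apply/eqP.
rewrite eqn_leq rank_leq_col leqNgt; apply/negP=> rk_lt.
have [p pp pF] := finPcharP F.
have p_le : (p <= #|F|)%N.
  apply: dvdn_leq; first exact: ltnW (card_finNzRing_gt1 F).
  exact: pchar_dvdn_card.
have := PGL_observability_bound U_orbit pF rk_lt.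
case/(exceptional_parameters pp p_le); rewrite ?subn_gt0 //.
- exact: observability_rank_gt0 U_orbit.
- case=> ->; rewrite subn1 => /= n1 qp.
  by apply: not_i; split; rewrite ?qp.
- case=> ->; rewrite subn1 => /= n2 q2.
  exact: not_ii.
Qed.

Lemma jordan_jump_transitive_line (F : finFieldType) :
  prime #|F| -> acts_transitively (fractional_jump (jordan_PGL F 1)).
Proof.
move=> pF; apply: jordan_jump_transitive => y.
have [k _ yk] := prime_card_natr (y ord0 ord0) pF.
by exists k => i; rewrite ord1 bin1.
Qed.

Lemma jordan_jump_transitive_plane (F : finFieldType) :
  #|F| = 2%N -> acts_transitively (fractional_jump (jordan_PGL F 2)).
Proof.
move=> F2; apply: jordan_jump_transitive => y.
have pF : prime #|F| by rewrite F2.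
have char2 : 2%:R = 0 :> F.
  have c2 : 2%N \in [pchar F] by apply: (@card_finPcharP F _ 1).
  by apply/eqP; rewrite -(dvdn_pcharf c2).
have [a a2 ya] := prime_card_natr (y ord0 ord0) pF.
have [b b2 yb] := prime_card_natr (y ord_max ord0) pF.
(* For a and b at most 1, C(2a + b, 2) = a modulo 2. *)
rewrite F2 in a2 b2; exists (2 * a + b)%N => i.
have [->|->] : i = ord0 \/ i = ord_max.
- by case: i => [[|[|]]] //= ?; [left|right]; apply: val_inj.
- rewrite ya; case: a a2 b b2 {ya yb} => [|[|//]] _ [|[|//]] _ //=.
  by rewrite -[RHS]/(1 + 2)%:R natrD char2 addr0.
by rewrite yb /= bin1 natrD natrM char2 mul0r add0r.
Qed.

Local Close Scope ring_scope.

Theorem theorem2p4 (F : finFieldType) (n : nat) (n_ge1 : 1 <= n) :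
  (~ (prime #|F| /\ n = 1) -> ~ (#|F| = 2 /\ n = 2) ->
     forall Psi : PGL F n,
       acts_transitively (PGL_perm Psi) <->
       acts_transitively (fractional_jump Psi))
  /\
  ((prime #|F| /\ n = 1) \/ (#|F| = 2 /\ n = 2) ->
     exists Psi : PGL F n,
       acts_transitively (fractional_jump Psi) /\
       ~ acts_transitively (PGL_perm Psi)).
Proof.
split=> [not_i not_ii Psi | exceptional].
  split; first exact: fractional_jump_transitive.
  exact: transitive_of_fractional_jump.
exists (jordan_PGL F n); split; last exact: jordan_nontransitive.
case: exceptional => [[F_prime ->] | [F2 ->]].
  exact: jordan_jump_transitive_line.
exact: jordan_jump_transitive_plane.
Qed.
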